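(* Let $X$ be a topological space, $Y \subseteq X$ and $x \in Y$. Then the following are equivalent: (1) The subspace $Y$ is radial at $x$. (2) For every cofinal $\mathcal{C} \subseteq \mathbf{Sp}(x,X)$, $Y \subseteq_x^X \bigcup \mathcal{C}$. Moreover, if $X$ is compact and Hausdorff, then (1) and (2) are also equivalent to: (3) For every cofinal $\mathcal{C} \subseteq \overline{\mathbf{Sp}}(x,X)$, $Y \subseteq_x^X \bigcup \mathcal{C}$.
   Context: No separation axioms are assumed unless stated. A transfinite sequence is a net whose domain is (nonempty and) well-ordered. A space $Z$ is radial at a point $z$ if for every $A \subseteq Z$ with $z \in \overline{A}$ there is a transfinite sequence with range in $A$ converging to $z$. A space is well-based at $z$ if $z$ has a neighbourhood base (neighbourhoods need not be open) well-ordered by $\supseteq$. A spoke at $x$ in $X$ is a subspace $S$ of $X$ with $x \in S$ such that $S$ is well-based at $x$. $\mathbf{Sp}(x,X)$ is the set of all spokes at $x$ in $X$, and $\overline{\mathbf{Sp}}(x,X)$ the set of those spokes which are closed in $X$. For $A,B \subseteq X$, write $A \subseteq_x^X B$ (''locally at $x$, $A$ is contained in $B$'') if there is a neighbourhood $U$ of $x$ in $X$ with $A \cap U \subseteq B$ (equivalently $x \notin \overline{A \setminus B}$). Both $\mathbf{Sp}(x,X)$ and $\overline{\mathbf{Sp}}(x,X)$ are quasi-ordered by $\subseteq_x^X$, and cofinal is meant with respect to this quasi-order: $\mathcal{C}$ is cofinal if every spoke $S$ in the quasi-ordered set satisfies $S \subseteq_x^X C$ for some $C \in \mathcal{C}$.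 *)

(* Defs.v *)
From mathcomp Require Import all_boot all_order all_algebra.
From mathcomp Require Import all_classical wochoice.
From mathcomp Require Import topology.

Set Implicit Arguments.
Unset Strict Implicit.
Unset Printing Implicit Defensive.

Local Open Scope classical_set_scope.

(* The filter of a net indexed by the directed set (I, R). *)
Definition tails (I : Type) (R : rel I) : set_system I :=
  filter_from [set: I] (fun i => [set j | R i j]).

(* [well_order R] makes [R] a reflexive total order in which every nonempty
   subset has a least element; the transfinite sequence is [u]. *)
Definition radial_at (Z : topologicalType) (z : Z) : Prop :=
  forall A : set Z, closure A z ->
    exists (I : Type) (R : rel I) (u : I -> Z),
      [/\ inhabited I, well_order R, (forall i, A (u i)) & u @ tails R --> z].

Definition well_based_at (Z : topologicalType) (z : Z) : Prop :=
  exists B : set (set Z),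
    nbhs z = filter_from B id /\
    wo_chain (fun V W : set Z => `[< W `<=` V >]) [in B].

(* A point of [A] as a point of the type [set_type A], which carries the
   subspace topology. *)
Definition subpoint (X : Type) (A : set X) (x : X) (Ax : A x) : set_type A :=
  SigSub (mem_set Ax).

Definition Sp (X : topologicalType) (x : X) : set (set X) :=
  [set S : set X | exists Sx : S x, well_based_at (subpoint Sx)].

Definition closed_Sp (X : topologicalType) (x : X) : set (set X) :=
  [set S : set X | Sp x S /\ closed S].

Definition subset_at (X : topologicalType) (x : X) (A B : set X) : Prop :=
  exists2 U, nbhs x U & A `&` U `<=` B.

Definition cofinal_at (X : topologicalType) (x : X) (P C : set (set X)) : Prop :=
  C `<=` P /\ forall S, P S -> exists2 T, C T & subset_at x S T.

(* Main.v *)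
Require Import Defs.
From mathcomp Require Import all_boot all_order all_algebra.
From mathcomp Require Import all_classical wochoice.
From mathcomp Require Import topology.

Local Open Scope classical_set_scope.

(** (1) implies (2): suppose [x] is in the closure of [A], the part of [Y] outside
the union of [C].  Take a well-ordered index of least length from which some
sequence in [A] has [x] in the closure of its range [B].  Radiality gives a
transfinite sequence [v] in [B] converging to [x]; sampling [v] at the least
stage after which it avoids the first [i] members of [B] makes it a convergent
sequence [w] indexed by the minimal length.  By minimality no proper initial
segment of [w] has [x] in its closure, so the tails of [w] form a base at [x] of
the subspace consisting of [x] and the range of [w], which is thus a spoke.  It
is not locally contained in a member of [C], as these miss [A].  For (3), use
that in a regular space the closure of a spoke is a spoke.

Conversely, if no transfinite sequence in [A] converges to [x], then [x] is not
in the closure of [S `&` A] for any spoke [S], so the spokes missing [A] are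
cofinal, and (2) or (3) puts [x] outside the closure of [A]. *)

(** * Well-ordered index sets *)

Section WellOrder.
Context {I : Type} {R : rel I}.

Lemma well_order_wo_chain : well_order R -> @wo_chain {classic I} R predT.
Proof. by move=> woR A _; exact: woR. Qed.

Lemma well_order_total : well_order R -> total R.
Proof. by move/well_order_wo_chain/wo_chainW => t i j; exact: t. Qed.

Lemma well_order_refl : well_order R -> reflexive R.
Proof. by move=> /well_order_total t i; rewrite -[R i i]orbb t. Qed.

Lemma well_order_anti : well_order R -> antisymmetric R.
Proof.
by move=> /well_order_wo_chain/wo_chain_antisymmetric a i j; exact: a.
Qed.

Lemma well_order_min (A : set I) : well_order R -> A !=set0 ->
  exists2 i, A i & forall j, A j -> R i j.
Proof.
move=> woR [i Ai]; have [|j [[Aj lbj] _]] := woR (mem A).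
  by exists i; apply/mem_set.
by exists j => [|k Ak]; [exact: set_mem | apply: lbj; exact/mem_set].
Qed.

(** The least of [i], [j], [k] can only be [i], by antisymmetry. *)
Lemma well_order_trans : well_order R -> transitive R.
Proof.
move=> woR j i k Rij Rjk.
have [|m mP mle] := @well_order_min [set i; j; k] woR.
  by exists i; left; left.
have Rim : R i m.
  case: mP => [[->|mj]|mk]; first exact: well_order_refl.
    by rewrite mj.
  move: mle; rewrite mk => mle; have Rkj : R k j by apply: mle; left; right.
  by rewrite (@well_order_anti woR k j) // Rkj.
have Rmi : R m i by apply: mle; left; left.
rewrite (@well_order_anti woR i m) ?Rim//.
by apply: mle; right.
Qed.

Lemma well_orderI : antisymmetric R ->
  (forall A : set I, A !=set0 -> exists2 i, A i & forall j, A j -> R i j) ->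
  well_order R.
Proof.
move=> Ra Rmin; apply: antisymmetric_well_order => // A [i Ai].
have [|j Aj lbj] := Rmin [set` A]; first by exists i.
by exists j.
Qed.

End WellOrder.

Lemma wo_chain_set_type (I : eqType) (R : rel I) (D : set I) :
  wo_chain R [in D] -> well_order (relpre (@set_val I D) R).
Proof.
move=> woD; apply: well_orderI.
  move=> i j /andP[Rij Rji]; apply: val_inj.
  apply: (wo_chain_antisymmetric woD); try exact: valP.
  by apply/andP.
move=> A [i Ai].
have [||_ [[/set_mem[j Aj <-] lbj] _]] := woD (mem (set_val @` A)).
- by move=> _ /set_mem[j Aj <-]; exact: valP.
- by exists (set_val i); apply/mem_set; exists i.
- by exists j => // k Ak; apply: lbj; apply/mem_set; exists k.
Qed.

Lemma well_order_set_type (I : Type) (R : rel I) (D : set I) :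
  well_order R -> well_order (relpre (@set_val I D) R).
Proof.
by move=> woR; apply: (@wo_chain_set_type {classic I}) => A _; exact: woR.
Qed.

(** * Neighbourhoods and closure in a subspace *)

Section Local.
Context {X : topologicalType}.
Implicit Types (x : X) (A B S T U : set X).

(** The set on the right is the image of [V] together with the complement of [S]. *)
Lemma nbhs_subpoint S x (Sx : S x) (V : set S) :
  nbhs (subpoint Sx) V <-> nbhs x [set y | forall z : S, set_val z = y -> V z].
Proof.
split.
  rewrite [nbhs (subpoint _)]nbhsE => -[W [[U oU <-] Ux] WV].
  have xU : nbhs x U by exact: open_nbhs_nbhs.
  apply: (filterS _ xU) => y Uy z zy.
  by apply: WV; rewrite /= zy.
rewrite [nbhs x]nbhsE => -[U [oU Ux] UV]; rewrite nbhsE.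
exists (set_val @^-1` U); first by split => //; exists U.
by move=> z /UV; exact.
Qed.

Lemma not_closureP A x :
  ~ closure A x <-> exists2 U, nbhs x U & forall y, U y -> ~ A y.
Proof.
split=> [|[U xU UA] /(_ U xU)[y [Ay /UA]]//].
move=> /existsNP[U /not_implyP[xU /nonemptyPn UA]].
by exists U => // y Uy Ay; have : (A `&` U) y by []; rewrite UA.
Qed.

Lemma subset_atP x A B : subset_at x A B <-> ~ closure (A `\` B) x.
Proof.
rewrite not_closureP; split=> -[U xU UAB]; exists U => //.
  by move=> y Uy [Ay]; apply; exact: UAB.
by move=> y [Ay /UAB]; apply: contra_notP.
Qed.

(** * Transfinite limits in [X], and radiality of a subspace *)

Definition transfinite_limit A x : Prop :=
  exists (I : Type) (R : rel I) (u : I -> X),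
    [/\ inhabited I, well_order R, (forall i, A (u i)) & u @ tails R --> x].

Lemma transfinite_limitS A B x :
  A `<=` B -> transfinite_limit A x -> transfinite_limit B x.
Proof.
move=> AB [I [R [u [? ? Au ?]]]]; exists I, R, u.
by split=> // i; exact: AB.
Qed.

Lemma well_order_unit : well_order (fun _ _ : unit => true).
Proof. by apply: well_orderI => [[] []//|A [i Ai]]; exists i. Qed.

(** [y] lies in every neighbourhood of [x], though without separation axioms the two may differ. *)
Lemma cvg_const_tails x y :
  closure [set y] x -> (fun _ : unit => y) @ tails (fun _ _ => true) --> x.
Proof. by move=> yx U /yx[_ [-> Uy]]; exists tt. Qed.

Lemma transfinite_limit_in A x : A x -> transfinite_limit A x.
Proof.
exists unit, (fun _ _ => true), (fun=> x).
split=> //; first exact: well_order_unit.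
by apply: cvg_const_tails; exact: subset_closure.
Qed.

Lemma radial_at_subpoint S x (Sx : S x) : radial_at (subpoint Sx) <->
  forall A, A `<=` S -> closure A x -> transfinite_limit A x.
Proof.
split=> rad A.
  move=> AS xA.
  have [|I [R [u [hI woR Au ux]]]] := rad (set_val @^-1` A).
    move=> V /nbhs_subpoint /xA [y [Ay Vy]].
    by exists (subpoint (AS _ Ay)); split => //; exact: Vy.
  exists I, R, (set_val \o u); split=> // U xU; apply: (ux (set_val @^-1` U)).
  by apply/nbhs_subpoint; apply: (filterS _ xU) => y Uy z zy; rewrite /= zy.
move=> xA.
have [_ [z _ <-]||I [R [u [hI woR Au ux]]]] := rad (set_val @` A).
- exact: set_valP.
- move=> U xU; have [|z [Az Uz]] := xA (set_val @^-1` U).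
    by apply/nbhs_subpoint; apply: (filterS _ xU) => y Uy z zy; rewrite /= zy.
  by exists (set_val z); split=> //; exists z.
have /choice[v vP] : forall i, exists z, A z /\ set_val z = u i.
  by move=> i; have [z Az zu] := Au i; exists z.
exists I, R, v; split=> // [i|V]; first by case: (vP i).
move=> /nbhs_subpoint/ux[i _ iV].
by exists i => // j Rij; apply: (iV j Rij); exact: (vP j).2.
Qed.

(** * Spokes *)

Lemma within_nbhsE S A x :
  within S (nbhs x) A = nbhs x [set y | S y -> A y].
Proof. by []. Qed.

Lemma nbhs_within S A x : nbhs x A -> within S (nbhs x) A.
Proof. by rewrite within_nbhsE => xA; apply: (filterS _ xA) => y Ay _. Qed.

(** The base is recast as a decreasing family in [X] indexed by a well order. Repetitions are
    allowed and [N i] may leave [S], so traces and closures of the family can be taken freely. *)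
Lemma SpP S x : Sp x S <-> S x /\ exists (I : Type) (R : rel I) (N : I -> set X),
  [/\ well_order R, (forall i j, R i j -> N j `<=` N i) &
      within S (nbhs x) = filter_from setT N].
Proof.
split.
  move=> [Sx [B [nbB woB]]]; split=> //.
  exists (set_type B), (relpre set_val (fun V W : set S => `[< W `<=` V >])).
  exists (fun V => set_val @` set_val V); split.
  - exact: wo_chain_set_type.
  - by move=> V W /asboolP VW; exact: image_subset.
  apply/seteqP; split=> A.
    rewrite within_nbhsE => xA; have : nbhs (subpoint Sx) (set_val @^-1` A).
      apply/nbhs_subpoint; apply: (filterS _ xA) => y Ay z zy.
      by move: Ay; rewrite -zy; apply; exact: set_valP.
    rewrite nbB => -[V BV VA]; exists (subpoint BV) => // _ [z Vz <-].
    exact: VA.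
  move=> [V _ VA].
  have /nbhs_subpoint : nbhs (subpoint Sx) (set_val V).
    by rewrite nbB; exists (set_val V) => //; exact: set_valP.
  rewrite within_nbhsE; apply: filterS => y Vy Sy; apply: VA.
  by exists (subpoint Sy) => //; exact: Vy.
move=> [Sx [I [R [N [woR NR NS]]]]]; exists Sx.
pose V i : set S := set_val @^-1` N i.
exists (range V); split.
  apply/seteqP; split=> A.
    move=> /nbhs_subpoint xA.
    have : within S (nbhs x) [set y | forall z : S, set_val z = y -> A z].
      exact: nbhs_within.
    rewrite NS => -[i _ iA]; exists (V i); first by exists i.
    by move=> z /iA; exact.
  move=> [_ [i _ <-] iA]; apply/nbhs_subpoint.
  have : within S (nbhs x) (N i) by rewrite NS; exists i.
  rewrite within_nbhsE; apply: filterS => y Ny z zy; apply: iA; rewrite /V/= zy.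
  by apply: Ny; rewrite -zy; exact: set_valP.
apply: antisymmetric_wo_chain.
  by move=> ? ? _ _ /andP[/asboolP ? /asboolP ?]; exact/seteqP.
move=> F FV [W FW].
(* Among the sets in [F], the one of least index is the largest. *)
have [|i Fi imin] := @well_order_min _ _ [set i | V i \in F] woR.
  by have /set_mem[i _ iW] := FV _ FW; exists i; rewrite /= iW.
exists (V i); split=> // W' FW'.
have /set_mem[j _ jW'] := FV _ FW'; apply/asboolP; rewrite -jW' => z.
by apply: NR; apply: imin; rewrite /= jW'.
Qed.

Lemma SpS S T x : Sp x S -> T `<=` S -> T x -> Sp x T.
Proof.
move=> /SpP[_ [I [R [N [woR NR NS]]]]] TS Tx; apply/SpP; split=> //.
exists I, R, (fun i => N i `&` T); split=> //.
  by move=> i j Rij; apply: setSI; exact: NR.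
apply/seteqP; split=> A.
  rewrite within_nbhsE => /(nbhs_within S _ _).
  by rewrite NS => -[i _ iA]; exists i => // y [/iA].
move=> [i _ iA]; have : within S (nbhs x) (N i) by rewrite NS; exists i.
rewrite !within_nbhsE; apply: filterS => y Ny Ty; apply: iA.
by split=> //; apply: Ny; exact: TS.
Qed.

(** The closures of the base sets form the new base: regularity makes them small, and an open [U]
    that meets [S] inside [N i] meets [closure S] inside [closure (N i)]. *)
Lemma Sp_closure S x : {for x, regular_space X} -> Sp x S -> Sp x (closure S).
Proof.
move=> regx /SpP[Sx [I [R [N [woR NR NS]]]]].
apply/SpP; split; first exact: subset_closure.
exists I, R, (closure \o N); split=> //.
  by move=> i j Rij; apply: closureS; exact: NR.
apply/seteqP; split=> A.
  move=> /regx[W xW WA]; have : within S (nbhs x) (S `&` W).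
    by rewrite within_nbhsE; apply: (filterS _ xW).
  rewrite NS => -[i _ iSW]; exists i => // y /(closureS iSW)/closureI[Sy Wy].
  exact: WA.
move=> [i _ iA]; have : within S (nbhs x) (N i) by rewrite NS; exists i.
rewrite !within_nbhsE [in X in X -> _]nbhsE => -[U [oU Ux] UN].
have xU : nbhs x U by exact: open_nbhs_nbhs.
apply: (filterS _ xU) => y Uy Sy; apply: iA => W yW.
have [|z [Sz [Uz Wz]]] := Sy (U `&` W).
  by apply: filterI yW; exact: open_nbhs_nbhs.
by exists z; split=> //; exact: UN.
Qed.

(** One point of [A] chosen in each base set gives a convergent sequence, since the base sets
    decrease. *)
Lemma Sp_transfinite_limit S A x : Sp x S -> A `<=` S -> closure A x ->
  transfinite_limit A x.
Proof.
move=> /SpP[_ [I [R [N [woR NR NS]]]]] AS xA.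
have /choice[u uP] : forall i, exists y, A y /\ N i y.
  move=> i; have /xA[y [Ay Ny]] : within S (nbhs x) (N i).
    by rewrite NS; exists i.
  by exists y; split=> //; apply: Ny; exact: AS.
have sub U : nbhs x U -> filter_from setT N U.
  by move=> /(nbhs_within S _ _); rewrite NS.
exists I, R, u; split=> //.
- by have [i] := sub setT filterT.
- by move=> i; case: (uP i).
- move=> U /sub[i _ iU]; exists i => // j Rij; apply/iU/(NR _ _ Rij).
  exact: (uP j).2.
Qed.

(** * From radiality to spokes, through sequences of minimal length *)

Lemma minimal_transfinite_sequence A x :
  (forall B, B `<=` A -> closure B x -> transfinite_limit B x) -> closure A x ->
  exists (I : Type) (R : rel I) (w : I -> X),
    [/\ well_order R, (forall i, A (w i)), w @ tails R --> x &
        forall i, ~ closure (w @` [set j | ~~ R i j]) x].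
Proof.
move=> rad /[dup] xA /(rad _ (@subset_refl _ _))[I [R [u [_ woR Au ux]]]].
(* [D] is long enough to index a subset of [A] with [x] in its closure; intersecting with [A] lets
   [f] be any function on [I]. *)
pose hits (D : set I) := exists f : I -> X, closure (A `&` f @` D) x.
pose below i := [set j | ~~ R i j].
(* [D] is the shortest initial segment that hits, or all of [I] if no proper one does. *)
have [D hitsD Dmin] : exists2 D, hits D & forall i, D i -> ~ hits (below i).
  have [[i hi]|nohit] := pselect (exists i, hits (below i)).
    have [|d hd dmin] := @well_order_min _ _ (hits \o below) woR.
      by exists i.
    by exists (below d) => // j ndj /dmin; apply/negP.
  exists setT; last by move=> i _ hi; apply: nohit; exists i.
  exists u => U /ux[i _ iU]; exists (u i); split; first by split; last exists i.
  by apply: iU; exact: well_order_refl.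
have {hitsD} [f xB] := hitsD.
have [|K [Q [v [_ woQ Bv vx]]]] := rad _ _ xB; first exact: subIsetl.
pose escapes i k := forall m, Q k m -> ~ (A `&` f @` below i) (v m).
(* For [i] in [D], minimality of [D] provides an escaping stage; outside [D] the value of [g] is
   arbitrary. *)
have /choice[g gP] : forall i, exists k,
    D i -> escapes i k /\ forall k', escapes i k' -> Q k k'.
  move=> i; have [Di|nDi] := pselect (D i); last first.
    have [k _ _] := vx _ (@filterT _ (nbhs x) _).
    by exists k.
  have [|k ek kmin] := @well_order_min _ _ (escapes i) woQ; last by exists k.
  have /not_closureP[U /vx[k _ kU] Ui] : ~ closure (A `&` f @` below i) x.
    by move=> xi; apply: (Dmin i Di); exists f.
  by exists k => m /kU /Ui.
have g_mono i j : D i -> D j -> R i j -> Q (g i) (g j).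
  move=> Di Dj Rij; apply: (gP i Di).2 => m /(gP j Dj).1; apply: contra_not.
  move=> -[Am [l nRil lm]]; split=> //; exists l => //.
  by apply: contra nRil; exact: well_order_trans.
have [g_cof|] := pselect (forall k, exists2 i, D i & Q k (g i)).
  exists (set_type D), (relpre set_val R), (v \o g \o set_val); split.
  - exact: well_order_set_type.
  - by move=> i; case: (Bv (g (set_val i))).
  - move=> U /vx[k _ kU]; have [i Di ki] := g_cof k.
    exists (subpoint Di) => // j Rij; apply: kU.
    apply: well_order_trans ki _ => //; apply: g_mono => //; exact: set_valP.
  (* A proper initial segment accumulating at [x] would make [below (set_val i)] hit, through the
     function [v \o g]. *)
  - move=> i xi; apply: (Dmin (set_val i)); first exact: set_valP.
    exists (v \o g); apply: closureS xi => _ [j nRij <-].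
    by split; [case: (Bv (g (set_val j))) | exists (set_val j)].
(* Here [D] has a greatest element, and the sequence can be taken constant. *)
move=> /existsNP[k /forall2NP kP].
have {}kP i : D i -> Q (g i) k.
  move=> Di; have [//|/negP nQ] := kP i.
  by have := well_order_total woQ (g i) k; rewrite (negbTE nQ) orbF.
(* [v k] is [f d], and [k] is at or after every [g i], so [d] lies below no [i] in [D]. *)
have [Ak [d Dd dk]] := Bv k.
have dmax i : D i -> R i d.
  move=> Di; apply: contrapT => /negP nRid.
  by apply: ((gP i Di).1 k (kP i Di)); split=> //; exists d.
exists unit, (fun _ _ => true), (fun=> v k); split=> //.
- exact: well_order_unit.
- apply: cvg_const_tails.
  (* Apart from [v k], all points are indexed below [d], and by minimality these do not accumulate
     at [x]. *)
  have : closure ((A `&` f @` below d) `|` [set v k]) x.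
    apply: closureS xB => y [Ay [i Di iy]]; subst y.
    have [Rdi|/negP nRdi] := pselect (R d i); last first.
      by left; split=> //; exists i.
    by right; rewrite -dk (@well_order_anti _ _ woR i d)// Rdi dmax.
  by rewrite closureU => -[xd|//]; case: (Dmin d Dd); exists f.
(* Proper initial segments of [unit] are empty. *)
- by move=> i /(_ _ filterT)[y [[j]]].
Qed.

Lemma Sp_of_radial A x :
  (forall B, B `<=` A -> closure B x -> transfinite_limit B x) -> closure A x ->
  exists B, [/\ B `<=` A, closure B x & Sp x (x |` B)].
Proof.
move=> rad /(minimal_transfinite_sequence _ _ rad)[I [R [w [woR Aw wx wP]]]].
exists (range w); split.
- by move=> _ [i _ <-].
- move=> U /wx[i _ iU]; exists (w i); split; first by exists i.
  by apply: iU; exact: well_order_refl.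
apply/SpP; split; first by left.
exists I, R, (fun i => x |` w @` [set j | R i j]); split=> //.
  move=> i j Rij; apply: setUS; apply: image_subset => k /=.
  exact: well_order_trans.
apply/seteqP; split=> U.
  move=> /[dup] /nbhs_singleton Ux /wx[i _ iU]; exists i => // _ [->|[j Rij <-]].
    by apply: Ux; left.
  by apply: iU => //; right; exists j.
(* In a neighbourhood of [x] missing the terms before [i], only [x] and the tail from [i] remain of
   the spoke. *)
move=> [i _ iU]; have /not_closureP[V xV Vi] := wP i.
rewrite within_nbhsE; apply: (filterS _ xV) => y Vy yS; apply: iU.
case: yS => [->|[j _ jy]]; first by left.
right; exists j => //=; apply: contrapT => /negP nRij.
by apply: (Vi y Vy); exists j.
Qed.

(** * Both implications for an abstract family [P], later [Sp x] or [closed_Sp x] *)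

Section Characterization.
Variables (P : set (set X)) (x : X).

Lemma subset_at_of_radial S (C : set (set X)) :
  (forall T, Sp x T -> exists2 T', P T' & T `<=` T') ->
  (forall A, A `<=` S -> closure A x -> transfinite_limit A x) ->
  cofinal_at x P C -> subset_at x S (\bigcup_(T in C) T).
Proof.
move=> SpP' rad [_ Ccof]; apply/subset_atP => xS.
have [B BS|B [BS xB /SpP'[T PT BT]]] := Sp_of_radial _ _ _ xS.
  by apply: rad; apply: subset_trans BS _; exact: subDsetl.
have [T' CT' [U xU UT']] := Ccof _ PT.
have [y [By Uy]] := xB U xU; have [_] := BS _ By; apply.
by exists T' => //; apply: UT'; split=> //; apply: BT; right.
Qed.

Lemma radial_of_subset_at S :
  P `<=` Sp x ->
  (forall T A, P T -> ~ A x -> ~ closure (T `&` A) x ->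
    exists2 T', P T' & T' `&` A = set0 /\ subset_at x T T') ->
  (forall C, cofinal_at x P C -> subset_at x S (\bigcup_(T in C) T)) ->
  forall A, A `<=` S -> closure A x -> transfinite_limit A x.
Proof.
move=> PSp avoid H A AS xA; apply: contrapT => nA.
pose C := [set T | P T /\ T `&` A = set0].
have /subset_atP : subset_at x S (\bigcup_(T in C) T).
  (* Cofinality of [C]: if a hypothesis of [avoid] failed, a sequence in [A], constant or drawn from
     [T], would converge to [x]. *)
  apply: H; split=> [T []//|T PT].
  have [|xTA|T' PT' [T'A TT']] := avoid T A PT; last by exists T'.
    by move=> Ax; apply: nA; exact: transfinite_limit_in.
  apply: nA; apply: transfinite_limitS (@subIsetr _ T A) _.
  exact: Sp_transfinite_limit (PSp _ PT) (@subIsetl _ _ _) xTA.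
apply; apply: closureS xA => y Ay; split; first exact: AS.
by move=> [T [_ TA] Ty]; have : (T `&` A) y by []; rewrite TA.
Qed.

End Characterization.

(** * Shrinking a spoke to miss a set *)

Lemma Sp_avoid S A x : Sp x S -> ~ A x -> ~ closure (S `&` A) x ->
  exists2 T, Sp x T & T `&` A = set0 /\ subset_at x S T.
Proof.
move=> spS nAx nSA; exists (S `\` A).
  by apply: SpS (spS) _ _; [exact: subDsetl | case: spS].
by split; [rewrite setDKI | apply/subset_atP; rewrite setDD].
Qed.

(** Removing [A] could destroy closedness, so [S] is cut with a closed neighbourhood of [x], which
    regularity places where [S] misses [A]. *)
Lemma closed_Sp_avoid S A x : {for x, regular_space X} ->
  closed_Sp x S -> ~ A x -> ~ closure (S `&` A) x ->
  exists2 T, closed_Sp x T & T `&` A = set0 /\ subset_at x S T.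
Proof.
move=> regx [spS cS] _ /not_closureP[U /regx[W xW WU] UA].
exists (S `&` closure W).
  split; last exact: closedI cS (@closed_closure _ _).
  apply: SpS (spS) (@subIsetl _ _ _) _; split; first by case: spS.
  exact: subset_closure (nbhs_singleton xW).
split; first by apply/seteqP; split=> // y [[Sy /WU /UA]] nSA Ay; exact: nSA.
by exists W => // y [Sy Wy]; split=> //; exact: subset_closure.
Qed.

End Local.

Theorem theorem1p12 (X : topologicalType) (Y : set X) (x : X) (Yx : Y x) :
  (radial_at (subpoint Yx) <->
   (forall C : set (set X), cofinal_at x (Sp x) C ->
      subset_at x Y (\bigcup_(S in C) S))) /\
  (compact [set: X] -> hausdorff_space X ->
   (radial_at (subpoint Yx) <->
    (forall C : set (set X), cofinal_at x (closed_Sp x) C ->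
       subset_at x Y (\bigcup_(S in C) S)))).
Proof.
split.
  rewrite radial_at_subpoint; split=> [rad C|].
    by apply: subset_at_of_radial rad => T SpT; exists T.
  by apply: radial_of_subset_at => // T A; exact: Sp_avoid.
move=> cX hX.
(* The whole space serves as a compact neighbourhood of [x]. *)
have regx : {for x, regular_space X} by exact: compact_regular hX cX filterT.
rewrite radial_at_subpoint; split=> [rad C|].
  apply: subset_at_of_radial rad => T SpT; exists (closure T).
    by split; [exact: Sp_closure | exact: closed_closure].
  exact: subset_closure.
apply: radial_of_subset_at => [T []//|T A]; exact: closed_Sp_avoid.
Qed.
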